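(* Let $r\ge 2$ and $c$ be integers and let $G_{r,c}$ be a balanced $c$-partite tournament with every partite set of size $r$, such that $$\delta(G_{r,c}) \ \geq\ \left\lfloor\frac{c-2}{4}\right\rfloor\big(r+\mu(G_{r,c})\big)\left(\frac{c-1}{c-2}\right).$$ Then $G_{r,c}$ contains a strongly connected subtournament $T$ of order $c$ such that $\delta(T)\ge \left\lfloor\frac{c-2}{4}\right\rfloor+1$, whenever one of the following holds: (i) $i_g(G_{r,c})\le \frac{r}{2}$, $c\ge 13$ and $c\notin\{14,15,18\}$; (ii) $i_g(G_{r,c})\le r$, $c\ge 17$ and $c\notin\{18,19,22\}$; (iii) $i_g(G_{r,c})\le \frac{3r}{2}$, $c\ge 21$ and $c\notin\{22,23,26\}$.
   Context: A $c$-partite tournament is a digraph obtained from a complete $c$-partite graph, with partite sets $V_1,\dots,V_c$, by orienting each edge (in exactly one direction). It is balanced if all partite sets have the same number of vertices; $G_{r,c}$ denotes a balanced $c$-partite tournament with $|V_i|=r$ for every $i\in[c]=\{1,\dots,c\}$. A subtournament of order $c$ of $G_{r,c}$ is a tournament induced by a set of $c$ vertices, necessarily one from each partite set. For a vertex $x$ of a digraph, $d^+(x)$ and $d^-(x)$ are its out-degree and in-degree. For an oriented graph $D$, $\delta(D)=\min_{x\in V(D)}\min\{d^+(x),d^-(x)\}$. The global irregularity of $D$ is $$i_g(D)=\max_{x,y\in V(D)}\big\{\max\{d^+(x),d^-(x)\}-\min\{d^+(y),d^-(y)\}\big\}.$$ For a vertex $x$ of a $c$-partite tournament $D$ and $i\in[c]$,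 let $d_i^+(x)=|V_i\cap N^+(x)|$ and $d_i^-(x)=|V_i\cap N^-(x)|$, where $N^+(x)$, $N^-(x)$ are the out- and in-neighbourhoods of $x$. The local partite irregularity of $D$ is $$\mu(D)=\max_{x\in V(D)}\max_{i\in[c]}|d_i^+(x)-d_i^-(x)|.$$ *)

(* Defs.v *)
From mathcomp Require Import all_boot all_order all_algebra.

Set Implicit Arguments.
Unset Strict Implicit.
Unset Printing Implicit Defensive.

Section Digraphs.

Variables (V : finType) (e : rel V).

Definition outN (x : V) : {set V} := [set y | e x y].
Definition inN (x : V) : {set V} := [set y | e y x].

Definition outdeg (x : V) : nat := #|outN x|.
Definition indeg (x : V) : nat := #|inN x|.

(* The default #|V| exceeds every degree of a loopless digraph, so it only
   matters when V is empty. *)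
Definition min_semidegree : nat :=
  \big[minn/#|V|]_(x : V) minn (outdeg x) (indeg x).

(* Truncated subtraction does not affect the maximum: the terms with x = y
   are nonnegative. *)
Definition global_irregularity : nat :=
  \max_(x : V) \max_(y : V)
     (maxn (outdeg x) (indeg x) - minn (outdeg y) (indeg y)).

Definition strongly_connected : Prop := forall x y : V, connect e x y.

Definition tournament : Prop :=
  irreflexive e /\ forall x y : V, x != y -> e x y (+) e y x.

End Digraphs.

Definition induced (V : finType) (e : rel V) (S : {set V}) :
    rel {x : V | x \in S} :=
  fun x y => e (val x) (val y).
Arguments induced {V} e S x y.

Section Multipartite.

Variables (V : finType) (c : nat) (part : V -> 'I_c) (e : rel V).

Definition partite_set (i : 'I_c) : {set V} := [set x | part x == i].

Definition partite_tournament : Prop :=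
  (forall x y : V, part x = part y -> ~~ e x y) /\
  (forall x y : V, part x <> part y -> e x y (+) e y x).

Definition balanced (r : nat) : Prop :=
  forall i : 'I_c, #|partite_set i| = r.

Definition part_outdeg (i : 'I_c) (x : V) : nat := #|partite_set i :&: outN e x|.
Definition part_indeg (i : 'I_c) (x : V) : nat := #|partite_set i :&: inN e x|.

Definition local_partite_irregularity : nat :=
  \max_(x : V) \max_(i < c)
     `|((part_outdeg i x)%:Z - (part_indeg i x)%:Z)%R|%N.

End Multipartite.

(* Main.v *)
(* A random transversal works.  Pick one vertex in each partite set uniformly
   and independently.  Given that x is picked, its out-degree in the transversal
   is a sum of c - 1 independent Bernoulli variables whose total mean is at least
   (c - 1)/2 - k/4, where k = 1, 2, 3 according to the bound on the global
   irregularity.  By Hoeffding's comparison theorem its lower tail at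
   g = (c - 2) %/ 4 is at most that of a binomial variable, and the latter is
   smaller than 1/(2c) for the allowed values of c.  A union bound over the c
   picked vertices and the two directions
   gives a transversal T with semidegrees at least g + 1.  A tournament on at
   most 4 g + 5 vertices with this property is strongly connected, since an
   initial and a terminal strong component would each have at least 2 g + 3
   vertices. *)

Require Import Defs.
From mathcomp Require Import all_boot all_order all_algebra.
From mathcomp Require Import ring lra zify.

Set Implicit Arguments.
Unset Strict Implicit.
Unset Printing Implicit Defensive.

Import Order.TTheory GRing.Theory Num.Theory.
Local Open Scope ring_scope.

(** * Generating polynomials of sums of independent Bernoulli variables *)

Section PoissonBinomial.

Variable R : realFieldType.
Implicit Types (a b p : R) (s : seq R) (Q : {poly R}).

(** Laws are encoded by generating polynomials: independence becomes a product, and changing a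
    parameter adds a multiple of [1 - 'X]. *)
Definition bern a : {poly R} := (1 - a)%:P + a *: 'X.

Definition pgf s : {poly R} := \prod_(a <- s) bern a.

Definition cdf g Q : R := \sum_(k < g.+1) Q`_k.

Definition proba a := 0 <= a <= 1.

Lemma pgf_cons a s : pgf (a :: s) = bern a * pgf s.
Proof. exact: big_cons. Qed.

Lemma pgf_perm s t : perm_eq s t -> pgf s = pgf t.
Proof. exact: perm_big. Qed.

Lemma bernE a : bern a = 1 - a *: (1 - 'X).
Proof.
by rewrite /bern polyCB polyC1 scalerBr alg_polyC; ring.
Qed.

Lemma coef_bern_mul0 a Q : (bern a * Q)`_0 = (1 - a) * Q`_0.
Proof. by rewrite mulrDl coefD coefCM -scalerAl coefZ coefXM mulr0 addr0. Qed.

Lemma coef_bern_mulS a Q k :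
  (bern a * Q)`_k.+1 = (1 - a) * Q`_k.+1 + a * Q`_k.
Proof. by rewrite mulrDl coefD coefCM -scalerAl coefZ coefXM. Qed.

Lemma deriv_bern a : (bern a)^`() = a%:P.
Proof. by rewrite derivD derivC derivZ derivX add0r alg_polyC. Qed.

Lemma pgf_coef_ge0 s k : all proba s -> 0 <= (pgf s)`_k.
Proof.
elim: s k => [|a s IH] k /=; first by rewrite /pgf big_nil coefC; case: ifP.
case/andP=> /andP[a0 a1] ps; rewrite pgf_cons; case: k => [|k].
  by rewrite coef_bern_mul0 mulr_ge0 ?subr_ge0 ?IH.
by rewrite coef_bern_mulS addr_ge0 ?mulr_ge0 ?subr_ge0 ?IH.
Qed.

Lemma pgf_rem a s : a \in s -> pgf s = bern a * pgf (rem a s).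
Proof. by move=> /perm_to_rem/pgf_perm->; rewrite pgf_cons. Qed.

Lemma deriv_pgf s : (pgf s)^`() = \sum_(a <- s) a *: pgf (rem a s).
Proof.
elim: s => [|b s IH]; first by rewrite /pgf !big_nil derivC.
rewrite pgf_cons derivM deriv_bern IH mulr_sumr big_cons /= eqxx mul_polyC.
congr (_ + _); rewrite big_seq [RHS]big_seq; apply: eq_bigr => a as_.
by rewrite -scalerAr; case: eqP as_ => [->|_] as_; rewrite ?pgf_cons // -pgf_rem.
Qed.

Lemma coef_1BX_mul0 Q : ((1 - 'X) * Q)`_0 = Q`_0.
Proof. by rewrite mulrBl mul1r coefB coefXM subr0. Qed.

Lemma coef_1BX_mulS Q k : ((1 - 'X) * Q)`_k.+1 = Q`_k.+1 - Q`_k.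
Proof. by rewrite mulrBl mul1r coefB coefXM. Qed.

(* Induction on k through k P(k) = \sum_a a P_a(k-1), where P_a is the law with
   the summand of parameter a removed. *)
Lemma pgf_nondecreasing s k :
  all proba s -> k%:R <= \sum_(a <- s) a -> 0 <= ((1 - 'X) * pgf s)`_k.
Proof.
elim: k s => [|k IH] s ps ks; first by rewrite coef_1BX_mul0 pgf_coef_ge0.
rewrite coef_1BX_mulS subr_ge0.
have Ek : k.+1%:R * (pgf s)`_k.+1 = \sum_(a <- s) a * (pgf (rem a s))`_k.
  have := congr1 (fun P : {poly R} => P`_k) (deriv_pgf s).
  rewrite coef_deriv mulr_natl => ->; rewrite coef_sum.
  by apply: eq_bigr => a _; rewrite coefZ.
rewrite -(ler_pM2l (ltr0Sn R k)) Ek.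
apply: (@le_trans _ _ (\sum_(a <- s) a * (pgf s)`_k)).
  by rewrite -mulr_suml ler_wpM2r // pgf_coef_ge0.
rewrite big_seq [leRHS]big_seq; apply: ler_sum => a as_.
have /andP[a0 a1] := allP ps _ as_.
(* With P_a the law without [a], P = P_a - a (1 - 'X) P_a. As a <= 1, the mean of P_a is still at
   least k, so induction gives P(k) <= P_a(k). *)
apply: ler_wpM2l => //; rewrite (pgf_rem as_) bernE mulrBl mul1r -scalerAl.
rewrite coefB coefZ gerBl mulr_ge0 // IH //.
  by apply/allP => b /mem_rem; apply: (allP ps).
have : \sum_(b <- s) b = a + \sum_(b <- rem a s) b.
  by rewrite (perm_big _ (perm_to_rem as_)) big_cons.
by move: ks; rewrite -natr1; lra.
Qed.

Lemma cdfD g P Q : cdf g (P + Q) = cdf g P + cdf g Q.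
Proof. by rewrite /cdf -big_split; apply: eq_bigr => i _; rewrite coefD. Qed.

Lemma cdfZ g a Q : cdf g (a *: Q) = a * cdf g Q.
Proof. by rewrite /cdf mulr_sumr; apply: eq_bigr => i _; rewrite coefZ. Qed.

(** The coefficients of [(1 - 'X) * Q] are successive differences, so their sum telescopes. *)
Lemma cdf_1BX g Q : cdf g ((1 - 'X) * Q) = Q`_g.
Proof.
elim: g => [|g IH]; first by rewrite /cdf big_ord1 coef_1BX_mul0.
rewrite /cdf big_ord_recr /= -/(cdf g _) IH coef_1BX_mulS; ring.
Qed.

Lemma cdf_Xn g k : cdf g 'X^k = (k <= g)%N%:R.
Proof.
rewrite /cdf; have [kg|gk] := leqP k g; last first.
  by rewrite big1 // => i _; rewrite coefXn ltn_eqF // (leq_ltn_trans _ gk) // -ltnS.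
rewrite (bigD1 (Ordinal (kg : k < g.+1)%N)) //= coefXn eqxx big1 ?addr0 // => i.
by rewrite coefXn -val_eqE /= => /negbTE->.
Qed.

Lemma cdf_bern_mono g a b s :
  all proba s -> a <= b -> cdf g (bern b * pgf s) <= cdf g (bern a * pgf s).
Proof.
move=> ps ab; have -> : bern a * pgf s
    = bern b * pgf s + (b - a) *: ((1 - 'X) * pgf s).
  by rewrite !bernE -!mul_polyC polyCB; ring.
by rewrite cdfD cdfZ cdf_1BX lerDl mulr_ge0 ?subr_ge0 // pgf_coef_ge0.
Qed.

(* Replacing the parameters a, b by p, a + b - p adds the second difference
   (p - a) (b - p) (1 - 'X)^2 to the product of the two factors. *)
Lemma cdf_bern2_mono g a b p s :
    all proba s -> g%:R <= \sum_(x <- s) x -> a <= p -> p <= b ->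
  cdf g (bern a * bern b * pgf s)
    <= cdf g (bern p * bern (a + b - p) * pgf s).
Proof.
move=> ps gs ap pb; have -> : bern p * bern (a + b - p) * pgf s
    = bern a * bern b * pgf s
      + ((p - a) * (b - p)) *: ((1 - 'X) * ((1 - 'X) * pgf s)).
  by rewrite !bernE -!mul_polyC !(polyCB, polyCD, polyCM); ring.
rewrite cdfD cdfZ cdf_1BX lerDl mulr_ge0 ?pgf_nondecreasing //.
by rewrite mulr_ge0 // subr_ge0.
Qed.

(** * Hoeffding's comparison with the binomial law *)

Lemma sum_nseq n p : \sum_(x <- nseq n p) x = p *+ n.
Proof. by rewrite big_nseq iter_addr_0. Qed.

Lemma sum_ge p s : {in s, forall x, p <= x} -> p *+ size s <= \sum_(x <- s) x.
Proof.
elim: s => [|a s IH] ps; first by rewrite big_nil.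
rewrite big_cons mulrS lerD ?ps ?mem_head // IH // => x xs.
by rewrite ps // inE xs orbT.
Qed.

Lemma sum_le p s : {in s, forall x, x <= p} -> \sum_(x <- s) x <= p *+ size s.
Proof.
elim: s => [|a s IH] ps; first by rewrite big_nil.
rewrite big_cons mulrS lerD ?ps ?mem_head // IH // => x xs.
by rewrite ps // inE xs orbT.
Qed.

(** Parameters are moved to [p] one at a time; [m] counts those already there. If all of [s] is at
    least [p], one is lowered to [p]; otherwise some a < p <= b are replaced by [p] and [a + b - p],
    which keeps the sum. Neither move decreases the tail. *)
Lemma cdf_hoeffding g p s m :
    all proba s -> proba p -> p *+ size s <= \sum_(x <- s) x ->
    g.+2%:R <= p *+ (size s + m) ->
  cdf g (pgf (s ++ nseq m p)) <= cdf g (pgf (nseq (size s + m) p)).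
Proof.
move: {2}(size s) (leqnn (size s)) => n; elim: n s m => [|n IH] s m.
  by rewrite leqn0 => /nilP->.
move=> ssn ps pp sp gp.
have [/allP sgep|/allPn[a as_]] := boolP (all (fun x => p <= x) s).
  case: s ssn ps sp gp sgep => [//|b s] /= ssn /andP[pb ps] sp gp sgep.
  have pb' : p <= b by rewrite sgep ?mem_head.
  have pall : all proba (s ++ nseq m p) by rewrite all_cat ps all_nseq pp orbT.
  rewrite pgf_cons; apply: (le_trans (cdf_bern_mono g pall pb')).
  rewrite -pgf_cons.
  have /pgf_perm-> : perm_eq (p :: s ++ nseq m p) (s ++ nseq m.+1 p).
    by rewrite (perm_catCA [:: p]).
  rewrite -[p :: _]/(nseq (size s + m).+1 p) -addnS; apply: IH; rewrite ?addnS //.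
  by apply: sum_ge => x xs; rewrite sgep // inE xs orbT.
rewrite -ltNge => ap.
have [b bs pb] : exists2 b, b \in rem a s & p <= b.
  apply/hasP; apply: contraTT sp => /hasPn sltp.
  rewrite -ltNge (perm_big _ (perm_to_rem as_)) (perm_size (perm_to_rem as_)).
  rewrite big_cons mulrS ltr_leD // sum_le // => x /sltp.
  by rewrite -ltNge => /ltW.
have Es : perm_eq s [:: a, b & rem b (rem a s)].
  by apply: (perm_trans (perm_to_rem as_)); rewrite perm_cons perm_to_rem.
set t := rem b (rem a s) in Es.
have Esum : \sum_(x <- s) x = a + (b + \sum_(x <- t) x).
  by rewrite (perm_big _ Es) !big_cons.
have Esz : size s = (size t).+2 by rewrite (perm_size Es).
have : all proba [:: a, b & t] by rewrite -(perm_all _ Es).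
rewrite /= => /and3P[pa_ pb_ pt]; move: (pa_) (pb_) (pp).
move=> /andP[a0 a1] /andP[b0 b1] /andP[p0 p1].
have -> : pgf (s ++ nseq m p) = bern a * bern b * pgf (t ++ nseq m p).
  by rewrite (pgf_perm (perm_cat Es (perm_refl _))) /= !pgf_cons mulrA.
have pall : all proba (t ++ nseq m p) by rewrite all_cat pt all_nseq pp orbT.
apply: (le_trans (cdf_bern2_mono pall _ (ltW ap) pb)).
  (* Dropping [a] and [b] costs at most 2, whence [g.+2] in the hypothesis: the remaining mean is at
     least [g]. *)
  rewrite big_cat /= sum_nseq.
  move: gp sp; rewrite mulrnDr Esum Esz -!natr1; lra.
have -> : bern p * bern (a + b - p) * pgf (t ++ nseq m p)
    = pgf ((a + b - p :: t) ++ nseq m.+1 p).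
  rewrite (mulrC (bern p)) -mulrA -!pgf_cons; apply: pgf_perm => /=.
  by rewrite perm_cons (perm_catCA [:: p]).
rewrite Esz addSnnS; apply: (IH (_ :: t)) => //=.
- by move: ssn; rewrite Esz.
- by rewrite pt andbT /proba; apply/andP; split; lra.
- by move: sp; rewrite big_cons Esum Esz [_ *+ _.+2]mulrS; lra.
- by rewrite -addSnnS -Esz.
Qed.

(** * Numerical bounds on binomial tails *)

Definition binom_pmf n p k : R := 'C(n, k)%:R * p ^+ k * (1 - p) ^+ (n - k).

Lemma pgf_nseq_coef n p k : (pgf (nseq n p))`_k = binom_pmf n p k.
Proof.
rewrite /binom_pmf; elim: n k => [|n IH] k /=.
  rewrite /pgf big_nil coefC; case: k => [|k]; last by rewrite bin0n !mul0r.
  by rewrite bin0 !expr0 !mulr1.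
rewrite pgf_cons; case: k => [|k].
  by rewrite coef_bern_mul0 IH !bin0 !subn0 exprS; ring.
rewrite coef_bern_mulS !IH binS natrD subSS exprS.
case: (ltnP k n) => [kn|nk]; last by rewrite (bin_small (nk : n < k.+1)%N); ring.
by rewrite -(subnSK kn) exprS; ring.
Qed.

(* Below n / 4 the ratio of consecutive terms is at least 3 p / (1 - p), so the
   tail is dominated by a geometric series. *)
Lemma binom_cdf_le n g p :
    4^-1 <= p <= 1 -> (4 * g < n)%N ->
  (4 * p - 1) * cdf g (pgf (nseq n p)) <= 3 * p * binom_pmf n p g.
Proof.
move=> /andP[p_ge p1] gn.
have pmf_ge0 k : 0 <= binom_pmf n p k.
  by rewrite /binom_pmf !mulr_ge0 ?exprn_ge0 ?ler0n //; lra.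
have step k : (k < g)%N -> 3 * p * binom_pmf n p k <= (1 - p) * binom_pmf n p k.+1.
  move=> kg; rewrite /binom_pmf (_ : n - k = (n - k.+1).+1)%N; last by lia.
  have /(congr1 (fun m => m%:R : R)) := mul_bin_left n k.
  rewrite !natrM => Ebin; rewrite -(ler_pM2l (ltr0Sn R k)) !exprS.
  set w := p * p ^+ k * ((1 - p) * (1 - p) ^+ (n - k.+1)).
  have w0 : 0 <= w by rewrite /w !mulr_ge0 ?exprn_ge0 //; lra.
  rewrite [leRHS](_ : _ = w * (k.+1%:R * 'C(n, k.+1)%:R)); last by rewrite /w; ring.
  rewrite Ebin [leLHS](_ : _ = w * ((3 * k.+1)%:R * 'C(n, k)%:R)); last first.
    by rewrite /w natrM; ring.
  by rewrite ler_wpM2l // -!natrM ler_nat leq_mul2r; lia.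
rewrite /cdf; under eq_bigr do rewrite pgf_nseq_coef.
elim: g gn step => [|g IH] gn step.
  by rewrite big_ord1; apply: ler_wpM2r => //; lra.
rewrite big_ord_recr /= mulrDr.
have := IH _ (fun k kg => step k (ltnW kg)); have := step g (ltnSn g).
have : (4 * g < n)%N by lia.
move=> -> /[swap] /(_ isT); lra.
Qed.

(** This step corresponds to raising c by 4. Denominators are cleared; the binomial coefficients are
    related by one diagonal and three downward absorption identities. *)
Lemma binom_pmf_step n g p :
    (g <= n)%N ->
  (g.+1 * (n.+3 - g) * (n.+2 - g) * (n.+1 - g))%:R * binom_pmf (4 + n) p g.+1
  = (n.+4 * n.+3 * n.+2 * n.+1)%:R * (p * (1 - p) ^+ 3) * binom_pmf n p g.
Proof.
move=> gn; rewrite /binom_pmf (_ : 4 + n - g.+1 = 3 + (n - g))%N; last by lia.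
have : (g.+1 * (n.+3 - g) * (n.+2 - g) * (n.+1 - g) * 'C(n.+4, g.+1)
      = n.+4 * n.+3 * n.+2 * n.+1 * 'C(n, g))%N.
  rewrite mulnC !mulnA (mulnC 'C(_, _)) -mul_bin_diag /=.
  rewrite -!mulnA -!(mulnCA 'C(_, _)) !mulnA (mulnC 'C(_, _)).
  rewrite -(mulnA n.+4) (mulnC 'C(_, _)) -mul_bin_down mulnA.
  rewrite -(mulnA (_ * n.+3)%N) (mulnC 'C(_, _)) -mul_bin_down mulnA.
  by rewrite -(mulnA (_ * n.+2)%N) (mulnC 'C(_, _)) -mul_bin_down mulnA.
move/(congr1 (fun m => m%:R : R)); rewrite !natrM => E.
rewrite exprD exprS [LHS](_ : _ = n.+4%:R * n.+3%:R * n.+2%:R * n.+1%:R * 'C(n, g)%:R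
  * (p * p ^+ g * ((1 - p) ^+ 3 * (1 - p) ^+ (n - g)))).
  ring.
rewrite -E; ring.
Qed.

(* By [binom_cdf_le] this bounds the tail at g of the binomial law (n, p) by
   1 / (2 (n + 1)). *)
Definition tail_small n g p :=
  2 * n.+1%:R * (3 * p * binom_pmf n p g) < 4 * p - 1.

(** For each j the difference of the two sides is a polynomial in [h] with nonnegative coefficients.
    The ratio 29/400 bounds p (1 - p)^3 in [tail_small_step]. *)
Lemma quartic_bound h j (n := (4 * (h + 2) + j.+1)%N) :
    (j <= 3)%N ->
  (29 * (n.+4.+1 * (n.+4 * n.+3 * n.+2)) <=
   400 * ((h + 2).+1 * (3 * (h + 2) + j.+2 + 2) * (3 * (h + 2) + j.+2 + 1)
          * (3 * (h + 2) + j.+2)))%N.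
Proof.
move=> j3; rewrite /n -(ler_nat R) !(natrM, natrD, mulrSr).
set x : R := h%:R; have x0 : 0 <= x by [].
have x2 : 0 <= x ^+ 2 by rewrite exprn_ge0.
have x3 : 0 <= x ^+ 3 by rewrite exprn_ge0.
have x4 : 0 <= x ^+ 4 by rewrite exprn_ge0.
by clear n; case: j j3 => [|[|[|[|//]]]] _ /=; lra.
Qed.

(* Going from n to n + 4 multiplies the left-hand side of [tail_small] by
   (n + 5) / (n + 1) * p * (1 - p)^3 * (n + 4) (n + 3) (n + 2) (n + 1) / D, which
   is less than 1. *)
Lemma tail_small_step g j p :
    (2 <= g)%N -> (j <= 3)%N -> (5 <= g + j)%N -> 23 / 50 <= p <= 2^-1 ->
  tail_small (4 * g + j.+1) g p -> tail_small (4 * g.+1 + j.+1) g.+1 p.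
Proof.
move=> g2 j3 gj /andP[p_ge p_le]; rewrite /tail_small => IH.
set n := (4 * g + j.+1)%N in IH.
rewrite (_ : 4 * g.+1 + j.+1 = 4 + n)%N; last by rewrite /n; lia.
apply: le_lt_trans IH.
have gn : (g <= n)%N by rewrite /n; lia.
(* On this range the product decreases in p; at p = 23/50 it is about 0.07243, just below 29/400 =
   0.0725. *)
have pq : p * (1 - p) ^+ 3 <= 29 / 400.
  set q := 1 - p; rewrite (_ : p = 1 - q); last by rewrite /q; ring.
  have [q_ge q_le] : 2^-1 <= q /\ q <= 27 / 50 by rewrite /q; lra.
  have q2 : q ^+ 2 <= 729 / 2500 by rewrite expr2; nra.
  by nra.
have pmf_ge0 : 0 <= binom_pmf n p g.
  by rewrite /binom_pmf !mulr_ge0 ?exprn_ge0 ?ler0n //; lra.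
set D := (g.+1 * (n.+3 - g) * (n.+2 - g) * (n.+1 - g))%N.
have D_gt0 : 0 < D%:R :> R by rewrite ltr0n /D !muln_gt0; lia.
rewrite -(ler_pM2l D_gt0).
rewrite [leLHS](_ : _ = 2 * n.+4.+1%:R * (3 * p)
   * (D%:R * binom_pmf (4 + n) p g.+1)); last by rewrite addSn /=; ring.
rewrite /D binom_pmf_step // -/D.
have key : (29 * (n.+4.+1 * (n.+4 * n.+3 * n.+2 * n.+1)) <= 400 * (n.+1 * D))%N.
  have E k : (n.+1 + k - g = 3 * g + j.+2 + k)%N by rewrite /n; lia.
  rewrite /D -[n.+3 in X in (_ <= X)%N](addn2 n.+1).
  rewrite -[n.+2 in X in (_ <= X)%N](addn1 n.+1).
  rewrite -[X in (_ * (X - g))%N]addn0 !E addn0.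
  rewrite (mulnA n.+4.+1) (mulnCA 29%N) mulnA mulnC (mulnCA 400%N) leq_pmul2l // /n.
  have [h ->] : exists h, g = (h + 2)%N by exists (g - 2)%N; lia.
  by rewrite mulnC quartic_bound.
set X : R := (n.+4 * n.+3 * n.+2 * n.+1)%:R.
have {}key : 29 * (n.+4.+1%:R * X) <= 400 * (n.+1%:R * D%:R).
  by rewrite -!natrM ler_nat.
have w_ge0 : 0 <= 6 * (p * binom_pmf n p g) by rewrite mulr_ge0 // mulr_ge0 //; lra.
rewrite [leLHS](_ : _ = 6 * (p * binom_pmf n p g)
  * (n.+4.+1%:R * X * (p * (1 - p) ^+ 3))); last by ring.
rewrite [leRHS](_ : _ = 6 * (p * binom_pmf n p g) * (n.+1%:R * D%:R)); last by ring.
apply: ler_wpM2l => //; apply: (@le_trans _ _ (n.+4.+1%:R * X * (29 / 400))).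
  by rewrite ler_wpM2l // mulr_ge0.
lra.
Qed.

(* With c = 4 g + j + 2, these are the least admissible orders c in each residue
   class modulo 4, when the global irregularity is at most e r / 2: 13, 16, 19,
   22 for e = 1; 17, 20, 23, 26 for e = 2; 21, 24, 27, 30 for e = 3. *)
Lemma tail_small_start e j p :
    (0 < e <= 3)%N -> (j <= 3)%N ->
    let g := (4 + e - j)%N in let n := (4 * g + j.+1)%N in
    p = 2^-1 - e%:R / (4 * n%:R) ->
  tail_small n g p.
Proof.
move=> e3 j3 g n ->; rewrite /tail_small /binom_pmf.
(* Falling factorials unfold the coefficient into products of small numerals, leaving twelve
   rational inequalities. *)
have -> : 'C(n, g)%:R = (n ^_ g)%:R / g`!%:R :> R.
  by rewrite -bin_ffact natrM mulfK // pnatr_eq0 -lt0n fact_gt0.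
move: @g @n; case: j j3 => [|[|[|[|//]]]] _; case: e e3 => [|[|[|[|//]]]] // _ g n.
all: let g' := eval compute in g in let n' := eval compute in n in
     change g with g'; change n with n'; clear g n.
all: rewrite !ffactSS ffactn0 !factS fact0 !natrM.
all: lra.
Qed.

(** The parameter [p] is the average guaranteed at the least admissible size [n0] of the residue
    class. It stays below the average for every larger size, so a single [p] serves the whole
    induction on [g]. *)
Lemma pgf_cdf_small e j g s :
    (0 < e <= 3)%N -> (j <= 3)%N -> (4 + e <= g + j)%N ->
    size s = (4 * g + j.+1)%N -> all proba s ->
    (size s)%:R / 2 - e%:R / 4 <= \sum_(x <- s) x ->
  2 * (size s).+1%:R * cdf g (pgf s) < 1.
Proof.
move=> e3 j3 egj szs ps sums.
set g0 := (4 + e - j)%N; set n0 := (4 * g0 + j.+1)%N.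
set p : R := 2^-1 - e%:R / (4 * n0%:R).
have n0_gt0 : 0 < n0%:R :> R by rewrite ltr0n /n0; lia.
have p_ge : 23 / 50 <= p.
  (* The largest value is 3/80, attained at e = j = 3 with n0 = 20. *)
  have : e%:R / (4 * n0%:R) <= 1 / 25 :> R.
    rewrite ler_pdivrMr; last by rewrite mulr_gt0.
    have : (25 * e <= 4 * n0)%N by rewrite /n0 /g0; lia.
    by rewrite -(ler_nat R) !natrM; lra.
  by rewrite /p; lra.
have p_le : p <= 2^-1.
  by rewrite /p gerBl divr_ge0 // mulr_ge0 // ltW.
have small : tail_small (4 * g + j.+1) g p.
  have -> : g = (g0 + (g - g0))%N by rewrite /g0; lia.
  elim: (g - g0)%N => [|d IH]; first by rewrite addn0; apply: tail_small_start.
  rewrite (addnS g0); apply: tail_small_step; rewrite ?p_ge ?p_le ?IH //;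
    rewrite /g0; lia.
move: small; rewrite -szs /tail_small => small.
have gn : (4 * g < size s)%N by rewrite szs; lia.
have gR : 5 <= g%:R + j%:R :> R by rewrite -natrD ler_nat; lia.
have jR : j%:R <= 3 :> R by rewrite ler_nat.
have szR : (size s)%:R = 4 * g%:R + j%:R + 1 :> R.
  by rewrite szs -[j.+1]addn1 addnA natrD (natrD _ _ j) natrM.
have := @cdf_hoeffding g p s 0 ps.
rewrite cats0 addn0 => /(_ _ _ _) hoeff.
have {}hoeff : cdf g (pgf s) <= cdf g (pgf (nseq (size s) p)).
  apply: hoeff.
  - by rewrite /proba; apply/andP; split; lra.
  - apply: le_trans sums; rewrite -(mulr_natr p) /p mulrBl mulrC lerB //.
    rewrite mulrAC ler_pdivlMr; last by rewrite mulr_gt0.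
    rewrite (_ : e%:R / 4 * (4 * n0%:R) = e%:R * n0%:R); last by field.
    by rewrite ler_wpM2l // ler_nat szs /n0 /g0; lia.
  - rewrite -(mulr_natr p) -[g.+2]addn2 natrD szR.
    apply: (@le_trans _ _ (23 / 50 * (4 * g%:R + j%:R + 1))); first by lra.
    by rewrite ler_wpM2r // addr_ge0 // addr_ge0 // mulr_ge0.
have pn : 4^-1 <= p <= 1 by apply/andP; split; lra.
have := binom_cdf_le pn gn => tl.
rewrite -(ltr_pM2l (_ : 0 < 4 * p - 1)); last by lra.
rewrite mulr1; apply: le_lt_trans small.
rewrite mulrCA ler_wpM2l ?mulr_ge0 //; apply: le_trans tl.
by rewrite ler_wpM2l //; lra.
Qed.

End PoissonBinomial.

(** * Semidegrees and strong connectivity of tournaments *)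

Lemma tournament_rev (W : finType) (e : rel W) :
  tournament e -> tournament (fun x y => e y x).
Proof. by case=> irr tot; split=> // x y xy; rewrite addbC tot. Qed.

(** Inside [A] the out-degrees and the in-degrees have equal sums, so the average out-degree is (|A|
    - 1) / 2. *)
Lemma tournament_card_ge (W : finType) (e : rel W) (A : {set W}) d :
    tournament e -> A != set0 ->
    {in A, forall x, (d <= #|A :&: outN e x|)%N} -> (2 * d < #|A|)%N.
Proof.
move=> [irr tot] /set0Pn[a aA] dA.
have cardE (e' : rel W) x :
    #|A :&: [set y | e' x y]| = (\sum_(y in A) e' x y)%N.
  rewrite -sum1_card big_mkcond [RHS]big_mkcond /=; apply: eq_bigr => y _.
  by rewrite !inE; case: (y \in A); case: (e' x y).
have sum_tot : (\sum_(x in A) #|A :&: outN e x|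
              + \sum_(x in A) #|A :&: inN e x| = #|A| * #|A|.-1)%N.
  rewrite -big_split -sum_nat_const; apply: eq_bigr => x xA /=.
  rewrite (cardE e) (cardE (fun x y => e y x)) -big_split /=.
  rewrite (bigD1 x) //= irr add0n (eq_bigr (fun=> 1%N)) => [|y /andP[_ yx]].
    by rewrite sum1dep_card (cardD1 x A) xA add1n; apply: eq_card => y;
      rewrite !inE andbC.
  by have := tot x y; rewrite eq_sym yx => /(_ isT); case: (e x y); case: (e y x).
have sum_sym : (\sum_(x in A) #|A :&: inN e x| = \sum_(x in A) #|A :&: outN e x|)%N.
  under eq_bigr do rewrite (cardE (fun x y => e y x)).
  under [RHS]eq_bigr do rewrite (cardE e).
  exact: exchange_big.
have dsum : (#|A| * d <= \sum_(x in A) #|A :&: outN e x|)%N.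
  by rewrite -sum_nat_const leq_sum.
have A0 : (0 < #|A|)%N by apply/card_gt0P; exists a.
have : (#|A| * (2 * d) <= #|A| * #|A|.-1)%N by rewrite -sum_tot sum_sym; lia.
by rewrite leq_pmul2l //; lia.
Qed.

(** The bound [d <= #|W|] accounts for the default value of the big minimum. *)
Lemma leq_min_semidegree (W : finType) (e : rel W) d :
    (d <= #|W|)%N ->
  (d <= min_semidegree e)%N <-> (forall x, (d <= outdeg e x) && (d <= indeg e x))%N.
Proof.
move=> dW; rewrite /min_semidegree; split=> [dmin x|dP]; last first.
  by apply: (big_ind (fun m => d <= m)%N) => // [m n dm dn|x _]; rewrite leq_min ?dm.
rewrite -leq_min; apply: leq_trans dmin _.
elim: (index_enum W) (mem_index_enum x) => // y s IH.
rewrite big_cons inE => /predU1P[->|/IH]; first exact: geq_minl.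
by apply: leq_trans; apply: geq_minr.
Qed.

(* The set of vertices reachable from x and the set of those reaching y both
   have more than 2 d elements, so they meet. *)
Lemma tournament_strong (W : finType) (e : rel W) d :
    tournament e -> (d <= #|W|)%N -> (d <= min_semidegree e)%N ->
    (#|W| <= 4 * d + 1)%N ->
  strongly_connected e.
Proof.
move=> tour dW dmin Wd x y; apply: contraT => nxy.
have dP z : (d <= outdeg e z)%N /\ (d <= indeg e z)%N.
  by apply/andP; apply: (proj1 (leq_min_semidegree _ dW)) z.
set A := [set z | connect e x z]; set B := [set z | connect e z y].
have cA : (2 * d < #|A|)%N.
  apply: (tournament_card_ge tour) => [|z].
    by apply/set0Pn; exists x; rewrite inE connect0.
  rewrite inE => xz; rewrite (setIidPr _) ?(dP z).1 //.
  apply/subsetP=> w; rewrite !inE => zw.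
  exact: connect_trans xz (connect1 zw).
have cB : (2 * d < #|B|)%N.
  apply: (tournament_card_ge (tournament_rev tour)) => [|z].
    by apply/set0Pn; exists y; rewrite inE connect0.
  rewrite inE => zy; rewrite (setIidPr _) ?(dP z).2 //.
  apply/subsetP=> w; rewrite !inE => zw.
  exact: connect_trans (connect1 zw) zy.
have : A :&: B = set0.
  apply/setP=> z; rewrite !inE; apply: contraNF nxy => /andP[xz zy].
  exact: connect_trans xz zy.
move=> AB0; have := cardsUI A B; rewrite AB0 cards0 addn0.
have : (#|A :|: B| <= #|W|)%N by exact: max_card.
lia.
Qed.

(** * Counting transversals with a vertex of low degree *)

Section Transversals.

Variables (r c : nat) (V : finType) (part : V -> 'I_c).
Hypothesis bal : balanced part r.
Implicit Types (e : rel V) (f : {ffun 'I_c -> V}).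

Definition transversals : {set {ffun 'I_c -> V}} :=
  [set f in family (partite_set part)].

(** In-degrees are handled by taking the reversed relation for [e]. *)
Definition low_transversals e g x : {set {ffun 'I_c -> V}} :=
  [set f in transversals | (f (part x) == x) && (#|[set i | e x (f i)]| <= g)%N].

Lemma card_balanced : #|V| = (c * r)%N.
Proof.
rewrite -sum1_card (partition_big part xpredT) //= -[c in RHS]card_ord.
rewrite -sum_nat_const; apply: eq_bigr => i _; rewrite -(bal i) -sum1_card.
by apply: eq_bigl => y; rewrite inE.
Qed.

Lemma card_transversals : #|transversals| = (r ^ c)%N.
Proof.
rewrite cardsE card_family -[X in (r ^ X)%N](size_enum_ord c) /image_mem.
by elim: (enum _) => //= i s ->; rewrite bal expnS.
Qed.

(** The part of x is removed because the vertex picked there is x itself. *)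
Definition part_probs e x : seq rat :=
  [seq #|partite_set part i :&: outN e x|%:R / r%:R | i <- rem (part x) (enum 'I_c)].

(* The generating polynomial of the out-degree of x over the transversals
   through x is the product over the other partite sets of d_i 'X + (r - d_i). *)
Lemma low_transversals_card e g x :
    (0 < r)%N -> ~~ e x x ->
  #|low_transversals e g x|%:R
    = r%:R ^+ c.-1 * cdf g (pgf (part_probs e x)) :> rat.
Proof.
move=> r0 exx; pose j := part x.
(* Conditioning on picking x shrinks its part to a singleton, so the choices still form a
   product. *)
pose A i := if i == j then [set x] else partite_set part i.
have Elow : low_transversals e g x
    = [set f in family A | (#|[set i | e x (f i)]| <= g)%N].
  apply/setP=> f; rewrite !inE andbA; congr (_ && _).
  apply/andP/familyP => [[/familyP fT /eqP fj] i|fA].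
    by rewrite /A; case: eqP => [->|_]; [rewrite inE fj | apply: fT].
  split; last by have := fA j; rewrite /A eqxx inE.
  apply/familyP => i; have := fA i; rewrite /A; case: eqP => // ->.
  by rewrite !inE => /eqP->.
have Epoly : \sum_(f in family A) 'X^(#|[set i | e x (f i)]|)
    = r%:R ^+ c.-1 *: pgf (part_probs e x).
  transitivity (\prod_i \sum_(v in A i) 'X^(e x v) : {poly rat}).
    rewrite (bigA_distr_big_dep (fun i v => v \in A i)).
    apply: eq_bigr => f _; rewrite prodrXr -sum1dep_card big_mkcond /=.
    by congr ('X^_); apply: eq_bigr => i _; case: (e x _).
  rewrite -big_enum /=.
  have jin : part x \in enum 'I_c by rewrite mem_enum.
  rewrite (perm_big _ (perm_to_rem jin)) big_cons /=.
  rewrite [X in X * _](_ : _ = 1) ?mul1r; last first.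
    by rewrite /A eqxx big_set1 (negbTE exx).
  rewrite /pgf big_map -[in c.-1](size_enum_ord c) -(size_rem jin).
  rewrite -iter_mulr_1 -[size _](count_predT) -big_const_seq -scaler_prod.
  rewrite big_seq [RHS]big_seq; apply: eq_bigr => i.
  rewrite mem_rem_uniq ?enum_uniq // inE /A => /andP[/negbTE-> _].
  (* In the shape of [bernE], the sum over a part becomes r times a Bernoulli factor. *)
  have EX (b : bool) : 'X^b = 1 - b%:R *: (1 - 'X) :> {poly rat}.
    by case: b; rewrite ?scale0r ?subr0 // scale1r opprB addrC subrK.
  under eq_bigr do rewrite EX.
  rewrite sumrB -scaler_suml sumr_const bal bernE (scalerBr r%:R) scalerA.
  rewrite mulrCA divff ?pnatr_eq0 -?lt0n // mulr1 scaler_nat.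
  congr (_ - _ *: _); rewrite -natr_sum -sum1_card; congr _%:R.
  rewrite big_mkcond [RHS]big_mkcond /=; apply: eq_bigr => v _.
  by rewrite !inE; case: eqP; case: (e x v).
rewrite Elow -sum1_card natr_sum -cdfZ -Epoly /cdf.
under [RHS]eq_bigr do rewrite coef_sum.
rewrite exchange_big /=; under [RHS]eq_bigr => f _ do rewrite -/(cdf g 'X^_) cdf_Xn.
rewrite big_mkcond [RHS]big_mkcond /=; apply: eq_bigr => f _.
by rewrite inE; case: (f \in _); case: (_ <= _)%N.
Qed.

Lemma sum_part_outN e x : (\sum_i #|partite_set part i :&: outN e x| = outdeg e x)%N.
Proof.
rewrite /outdeg -sum1_card (partition_big part xpredT) //=.
apply: eq_bigr => i _; rewrite -sum1_card; apply: eq_bigl => y.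
by rewrite !inE andbC.
Qed.

(** There are [r ^ c.-1] transversals through x, so the conditional probability of a low out-degree
    is below 1/(2c). *)
Lemma low_transversals_small e g x k l :
    (0 < r)%N -> (forall y, part y = part x -> ~~ e x y) ->
    (0 < k <= 3)%N -> (l <= 3)%N -> (4 + k <= g + l)%N -> c = (4 * g + l.+2)%N ->
    (2 * c.-1 * r <= 4 * outdeg e x + k * r)%N ->
  (2 * c * #|low_transversals e g x| < r ^ c.-1)%N.
Proof.
move=> r0 exj k3 l3 kgl Ec degx.
have rR : 0 < r%:R :> rat by rewrite ltr0n.
have jin : part x \in enum 'I_c by rewrite mem_enum.
have szs : size (part_probs e x) = c.-1.
  by rewrite size_map size_rem // size_enum_ord.
have c1 : c = c.-1.+1 by rewrite Ec addnS.
rewrite -(ltr_nat rat) natrM low_transversals_card ?exj // mulrCA natrX.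
rewrite gtr_pMr ?exprn_gt0 // natrM [in X in _ * X%:R * _]c1 -szs.
apply: (@pgf_cdf_small _ k l) => //.
- by rewrite szs Ec !addnS.
- apply/allP=> p /mapP[i _ ->]; rewrite /proba divr_ge0 // ler_pdivrMr // mul1r.
  by rewrite ler_nat -(bal i) subset_leq_card // subsetIl.
rewrite szs big_map -mulr_suml -natr_sum.
have -> : (\sum_(i <- rem (part x) (enum 'I_c)) #|partite_set part i :&: outN e x|
    = outdeg e x)%N.
  rewrite -sum_part_outN -[RHS]big_enum (perm_big _ (perm_to_rem jin)) big_cons /=.
  rewrite [X in (X + _)%N](_ : _ = 0%N) ?add0n //.
  apply/eqP; rewrite cards_eq0 -subset0; apply/subsetP=> y; rewrite !inE.
  by case/andP=> /eqP/exj/negbTE->.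
rewrite ler_pdivlMr //; move: degx; rewrite -(ler_nat rat) natrD !natrM; lra.
Qed.

Lemma transversal_semidegree_gt e g k l :
    partite_tournament part e -> (0 < r)%N ->
    (0 < k <= 3)%N -> (l <= 3)%N -> (4 + k <= g + l)%N -> c = (4 * g + l.+2)%N ->
    (forall x, 2 * c.-1 * r <= 4 * minn (outdeg e x) (indeg e x) + k * r)%N ->
  exists2 f, f \in transversals & forall j,
    (g < #|[set i | e (f j) (f i)]|)%N && (g < #|[set i | e (f i) (f j)]|)%N.
Proof.
move=> [eP _] r0 k3 l3 kgl Ec deg.
pose e' x y := e y x.
have small e1 : e1 = e \/ e1 = e' -> forall x,
    (2 * c * #|low_transversals e1 g x| < r ^ c.-1)%N.
  move=> e1E x; apply: low_transversals_small k3 l3 kgl Ec _ => //.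
    by move=> y yx; case: e1E => ->; apply: eP; rewrite yx.
  have := deg x; case: e1E => ->; [|rewrite -[indeg e x]/(outdeg e' x)]; lia.
pose bad := \bigcup_x (low_transversals e g x :|: low_transversals e' g x).
have : ~~ (transversals \subset bad).
  apply/negP=> /subset_leq_card; apply/negP; rewrite -ltnNge card_transversals.
  have card_bad : (#|bad| <= \sum_x (#|low_transversals e g x|
                                   + #|low_transversals e' g x|))%N.
    rewrite /bad; elim/big_rec2: _ => [|x m B _ Bm]; first by rewrite cards0.
    by rewrite (leq_trans (leq_card_setU _ _)) // leq_add // leq_card_setU.
  have c0 : (0 < c)%N by rewrite Ec addnS.
  rewrite -(ltn_pmul2l (_ : 0 < 2 * c)%N) ?muln_gt0 //.
  (* The union bound runs over all c r vertices and both directions. Passing to the predecessor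
     turns each strict bound into a weak one that can be summed. *)
  apply: (@leq_ltn_trans (\sum_(x : V) (2 * (r ^ c.-1).-1))%N).
    apply: leq_trans (leq_mul (leqnn _) card_bad) _.
    rewrite big_distrr; apply: leq_sum => x _ /=; rewrite mulnDr (mul2n _.-1) -addnn.
    rewrite leq_add // -ltnS prednK ?expn_gt0 ?r0 //; apply: small; tauto.
  rewrite sum_nat_const card_balanced (_ : r ^ c = r * r ^ c.-1)%N;
    last by rewrite -expnS prednK.
  have : (0 < r ^ c.-1)%N by rewrite expn_gt0 r0.
  case: (r ^ c.-1)%N => // X _ /=.
  rewrite [X in (_ < X)%N](_ : _ = c * r * (2 * X.+1))%N; last by ring.
  by rewrite ltn_pmul2l ?muln_gt0 ?c0 //; lia.
move=> /subsetPn[f fT fgood]; exists f => // j.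
have fj : part (f j) = j.
  by move: fT; rewrite inE => /familyP/(_ j); rewrite inE => /eqP.
rewrite !ltnNge -negb_or; apply: contra fgood => low.
apply/bigcupP; exists (f j) => //; rewrite in_setU.
by do 2![rewrite [_ \in low_transversals _ _ _]inE]; rewrite fT fj eqxx.
Qed.

End Transversals.

(** * From global irregularity to the subtournament *)

Lemma degree_sum (r c : nat) (V : finType) (part : V -> 'I_c) (e : rel V) x :
    partite_tournament part e -> balanced part r ->
  (outdeg e x + indeg e x = c.-1 * r)%N.
Proof.
move=> [eP tot] bal.
have /eqP := cardsC (partite_set part (part x)).
rewrite bal (card_balanced bal) -subn1 mulnBl mul1n => /eqP <-; rewrite addKn.
rewrite /outdeg /indeg -!sum1_card big_mkcond [X in (_ + X)%N]big_mkcond.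
rewrite -big_split /=.
rewrite [RHS]big_mkcond; apply: eq_bigr => y _; rewrite !inE.
case: eqP => [/esym xy|/nesym/tot]; last by case: (e x y); case: (e y x).
by rewrite (negbTE (eP _ _ xy)) (negbTE (eP _ _ (esym xy))).
Qed.

Theorem theorem4 (r c : nat) (V : finType) (part : V -> 'I_c) (e : rel V)
  (hr : (2 <= r)%N)
  (hG : partite_tournament part e)
  (hbal : balanced part r)
  (hdelta : ((c - 2) %/ 4)%N%:R
              * (r%:R + (local_partite_irregularity part e)%:R)
              * ((c%:R - 1) / (c%:R - 2))
            <= (min_semidegree e)%:R :> rat)
  (hcases :
     [\/ [/\ (global_irregularity e)%:R <= r%:R / 2 :> rat,
             (13 <= c)%N & c \notin [:: 14; 15; 18]%N],
         [/\ (global_irregularity e)%:R <= r%:R :> rat,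
             (17 <= c)%N & c \notin [:: 18; 19; 22]%N]
       | [/\ (global_irregularity e)%:R <= 3 * r%:R / 2 :> rat,
             (21 <= c)%N & c \notin [:: 22; 23; 26]%N]]) :
  exists S : {set V},
    [/\ #|S| = c,
        tournament (induced e S),
        strongly_connected (induced e S)
      & (((c - 2) %/ 4).+1 <= min_semidegree (induced e S))%N].
Proof.
move=> {hdelta}; set g := ((c - 2) %/ 4)%N; pose l := ((c - 2) %% 4)%N.
have l3 : (l <= 3)%N by rewrite /l; lia.
(* Case number k bounds the irregularity by k r / 2. From its lower bound on c onwards, the excluded
   orders are exactly those with g + l < 4 + k. *)
have [k [k3 [kgl [Ec ig]]]] : exists k, (0 < k <= 3)%N /\ (4 + k <= g + l)%N
    /\ c = (4 * g + l.+2)%N /\ (2 * global_irregularity e <= k * r)%N.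
  rewrite /g /l; case: hcases => [[ig c13 cN]|[ig c13 cN]|[ig c13 cN]];
    [exists 1%N|exists 2|exists 3]; (split=> //; split; [|split]);
    try (move: cN; rewrite !inE; lia);
    by rewrite -(ler_nat rat) !natrM; lra.
have deg x : (2 * c.-1 * r <= 4 * minn (outdeg e x) (indeg e x) + k * r)%N.
  (* Taking x = y in the irregularity bounds the gap between the two degrees of x, whose sum is (c -
     1) r. *)
  have : (maxn (outdeg e x) (indeg e x) - minn (outdeg e x) (indeg e x)
          <= global_irregularity e)%N.
    by rewrite /global_irregularity (bigD1 x) //= leq_max (bigD1 x) //= leq_maxl.
  by have := degree_sum x hG hbal; lia.
have [f fT fdeg] := transversal_semidegree_gt hbal hG (ltnW hr) k3 l3 kgl Ec deg.
have partf j : part (f j) = j.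
  by move: fT; rewrite inE => /familyP/(_ j); rewrite inE => /eqP.
have f_inj : injective f by apply: (can_inj partf).
pose S := f @: setT.
have fS j : f j \in S by apply: imset_f.
pose h j : {x | x \in S} := exist _ (f j) (fS j).
have h_inj : injective h by move=> i j /(congr1 val)/f_inj.
have hE (u : {x | x \in S}) : exists j, u = h j.
  by case: u => x xS; have /imsetP[j _ xj] := xS; exists j; apply: val_inj.
have tourS : tournament (induced e S).
  split=> [u|u v uv]; first by apply: negbTE; apply: hG.1.
  apply: hG.2; have [i Eu] := hE u; have [j Ev] := hE v.
  by apply: contra_neq_not uv; rewrite Eu Ev /= !partf => ->.
have cardS : #|S| = c by rewrite card_imset // cardsT card_ord.
have cardsS : #|{: {x | x \in S}}| = c by rewrite card_sig -cardS.
have dS : (g.+1 <= min_semidegree (induced e S))%N.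
  apply/leq_min_semidegree; first by rewrite cardsS; lia.
  move=> u; have [j ->] := hE u; have /andP[dout din] := fdeg j.
  rewrite (leq_trans dout) ?(leq_trans din) //.
    rewrite -(card_imset _ h_inj); apply/subset_leq_card/subsetP=> v.
    by case/imsetP=> i; rewrite inE => fij ->; rewrite inE.
  rewrite -(card_imset _ h_inj); apply/subset_leq_card/subsetP=> v.
  by case/imsetP=> i; rewrite inE => fij ->; rewrite inE.
exists S; split=> //.
(* Since l <= 3, c = 4 g + l + 2 is at most 4 (g + 1) + 1. *)
by apply: tournament_strong dS _ => //; rewrite cardsS; lia.
Qed.
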